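(* Consider the fully discrete one-dimensional DDG scheme with zero-flux boundary conditions described in the context. If the initial data $c_{ih}^0$, $i=1,\dots,m$, is already at (discrete) steady state, then $c_{ih}^n=c_{ih}^0$ for all $n\ge1$ and all $i$, with any time step $\Delta t>0$.
   Context: **Mesh and space.** $\Omega=\bigcup_{j=1}^NI_j$ is an interval, $I_j=[x_{j-1/2},x_{j+1/2}]$, $h=|I_j|$ uniform, and $V_h=\{v\in L^2(\Omega):v|_{I_j}\in P^k(I_j)\ \forall j\}$ with $P^k$ the polynomials of degree at most $k$. At interior nodes, $[w]=w^+-w^-$ and $\{w\}=\frac12(w^++w^-)$; $w|_{x_{j-1/2}}^{x_{j+1/2}}=w(x_{j+1/2}^-)-w(x_{j-1/2}^+)$. $\Pi$ is the piecewise $L^2$ projection onto $V_h$. The charges $q_i$, the fixed charge $\rho_0=\rho_0(x)$ and the (time-independent) boundary data $\psi_D,\sigma$ are given. **Discrete Poisson problem (DP).** Given $c_{ih}\in V_h$ ($1\le i\le m$), find $\psi_h\in V_h$ such that for all $\eta\in V_h$ and all $j$, $$\int_{I_j}\partial_x\psi_h\partial_x\eta\,dx-\left.\left(\widehat{\partial_x\psi_h}\,\eta+(\psi_h-\{\psi_h\})\partial_x\eta\right)\right|_{x_{j-1/2}}^{x_{j+1/2}}=\int_{I_j}\Big(\sum_{i=1}^mq_ic_{ih}+\rho_0\Big)\eta\,dx,$$ with $\widehat{\partial_x\psi_h}=\beta_0'[\psi_h]/h+\{\partial_x\psi_h\}+\beta_1'h[\partial_x^2\psi_h]$ at interior nodes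 ($\beta_0',\beta_1'$ fixed parameters), and, with $\mathbf n$ the outward normal, $\{\psi_h\}=\psi_D$, $\widehat{\partial_{\mathbf n}\psi_h}=\frac{\beta_0'}h(\psi_D-\psi_h)+\partial_{\mathbf n}\psi_h$ at Dirichlet boundary points, $\{\psi_h\}=\psi_h$, $\widehat{\partial_{\mathbf n}\psi_h}=\sigma$ at Neumann boundary points. (DP) is assumed to be uniquely solvable for given $c_{ih}$ (as is the case when there is a Dirichlet boundary point and $\beta_0'$ is large enough). **Scheme.** Given $c_{ih}^n\in V_h$: let $\psi_h^n$ solve (DP) with $c_{ih}=c_{ih}^n$ and set $M_{ih}^n=e^{-q_i\psi_h^n}$; define $g_{ih}^n\in V_h$ by $\int_{I_j}g_{ih}^nM_{ih}^nr\,dx=\int_{I_j}c_{ih}^nr\,dx$ for all $r\in V_h$ and all $j$; define $c_{ih}^{n+1}\in V_h$ by: for all $v\in V_h$ and all $j$, $$\int_{I_j}\frac{c_{ih}^{n+1}-c_{ih}^n}{\Delta t}v\,dx=-\int_{I_j}M_{ih}^n\partial_xg_{ih}^n\partial_xv\,dx+\left.\{M_{ih}^n\}\left[\widehat{\partial_xg_{ih}^n}v+(g_{ih}^n-\{g_{ih}^n\})\partial_xv\right]\right|_{x_{j-1/2}}^{x_{j+1/2}},$$ with $\widehat{\partial_xg_{ih}}=\frac{\beta_0}h[g_{ih}]+\{\partial_xg_{ih}\}+\beta_1h[\partial_x^2g_{ih}]$ at interior nodes, and $\widehat{\partial_xg_{ih}}=0$, $\{g_{ih}\}=g_{ih}$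 at the two boundary nodes. **Steady state.** Discrete functions $c_{ih}$ ($1\le i\le m$) are at steady state if $$c_{ih}=c_i^\infty\,\Pi e^{-q_i\phi_h}$$ with constants $c_i^\infty>0$, where $\phi_h\in V_h$ satisfies (DP) with $\psi_h=\phi_h$ and with $c_{ih}$ replaced by $c_i^\infty\Pi e^{-q_i\phi_h}$ (a nonlinear algebraic equation for $\phi_h$). *)

(* Defs.v *)
From HB Require Import structures.
From mathcomp Require Import all_boot all_order all_algebra.
From mathcomp Require Import all_classical all_reals all_analysis.

Set Implicit Arguments.
Unset Strict Implicit.
Unset Printing Implicit Defensive.

Import Order.TTheory GRing.Theory Num.Theory.
Import numFieldNormedType.Exports.
Local Open Scope classical_set_scope.
Local Open Scope ring_scope.

(* One boundary condition for the potential: the prescribed value psi_D, or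
   the prescribed outward normal flux sigma. *)
Inductive boundary_condition (R : Type) :=
  | Dirichlet of R
  | Neumann of R.

Record ddg_problem (R : realType) (m : nat) := DDGProblem {
  xleft : R;
  meshsize : R;
  charge : 'I_m -> R;
  rho0 : R -> R;
  bc_left : boundary_condition R;
  bc_right : boundary_condition R;
  beta0 : R;            (* flux parameters of the concentration equations *)
  beta1 : R;
  pbeta0 : R;           (* flux parameters of the Poisson equation *)
  pbeta1 : R
}.

(* The cells are numbered 0, ..., N-1 and the nodes 0, ..., N: cell j is
   [node j, node j+1].  An element of V_h is the N-tuple of its polynomial
   pieces, all written in the global coordinate x. *)
Definition Vh (R : realType) (N k : nat) : {pred N.-tuple {poly R}} :=
  [pred v : N.-tuple {poly R} | all (fun p : {poly R} => (size p <= k.+1)%N) v].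
Arguments Vh {R N} k.

(* A piecewise function maps a cell and a point of that (closed) cell to a
   value; it may take two values at an interior node. *)
Definition broken (R : Type) := nat -> R -> R.

Section DDG.
Variables (R : realType) (N k m : nat) (D : ddg_problem R m).
Implicit Types (w : broken R) (v psi g : N.-tuple {poly R}) (j l : nat).
Implicit Types (c : 'I_m -> N.-tuple {poly R}).

Local Notation h := (meshsize D).

Definition node (i : nat) : R := xleft D + i%:R * h.

Definition cell_int j (f : R -> R) : R :=
  \int[lebesgue_measure]_(x in `[node j, node j.+1]) f x.

Definition dx (l : nat) v : broken R := fun j x => (v`_j)^`(l).[x].

Definition jump w (i : nat) : R := w i (node i) - w i.-1 (node i).

(* At the two boundary nodes the average is the only available trace. *)
Definition avg w (i : nat) : R :=
  if i == 0%N then w 0%N (node 0)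
  else if i == N then w N.-1 (node N)
  else (w i.-1 (node i) + w i (node i)) / 2.

(* F j i is a quantity attached to the node i and seen from the cell j. *)
Definition cell_bracket (F : nat -> nat -> R) j : R := F j j.+1 - F j j.

Definition interior_flux (b0 b1 : R) v (i : nat) : R :=
  b0 / h * jump (dx 0 v) i + avg (dx 1 v) i + b1 * h * jump (dx 2 v) i.

(* u and du are the trace of the potential and of its outward normal
   derivative. *)
Definition normal_flux (bc : boundary_condition R) (u du : R) : R :=
  match bc with
  | Dirichlet psiD => pbeta0 D / h * (psiD - u) + du
  | Neumann sigma => sigma
  end.

Definition boundary_value (bc : boundary_condition R) (u : R) : R :=
  match bc with
  | Dirichlet psiD => psiD
  | Neumann _ => u
  end.

(* The outward normal is -1 at the left endpoint, whence the two signs. *)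
Definition poisson_flux psi (i : nat) : R :=
  if i == 0%N then
    - normal_flux (bc_left D) (dx 0 psi 0%N (node 0)) (- dx 1 psi 0%N (node 0))
  else if i == N then
    normal_flux (bc_right D) (dx 0 psi N.-1 (node N)) (dx 1 psi N.-1 (node N))
  else interior_flux (pbeta0 D) (pbeta1 D) psi i.

Definition poisson_avg psi (i : nat) : R :=
  if i == 0%N then boundary_value (bc_left D) (dx 0 psi 0%N (node 0))
  else if i == N then boundary_value (bc_right D) (dx 0 psi N.-1 (node N))
  else avg (dx 0 psi) i.

Definition poisson c psi : Prop :=
  psi \in Vh k /\
  forall eta, eta \in Vh k -> forall j, (j < N)%N ->
    cell_int j (fun x => dx 1 psi j x * dx 1 eta j x)
    - cell_bracket (fun j l =>
        poisson_flux psi l * dx 0 eta j (node l)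
        + (dx 0 psi j (node l) - poisson_avg psi l) * dx 1 eta j (node l)) j
    = cell_int j (fun x =>
        (\sum_(i < m) charge D i * dx 0 (c i) j x + rho0 D x) * dx 0 eta j x).

Definition poisson_uniquely_solvable : Prop :=
  forall c, (forall i : 'I_m, c i \in Vh k) -> exists! psi, poisson c psi.

Definition boltzmann (q : R) psi : broken R :=
  fun j x => expR (- q * dx 0 psi j x).

Definition g_flux g (i : nat) : R :=
  if (i == 0%N) || (i == N) then 0
  else interior_flux (beta0 D) (beta1 D) g i.

Definition ddg_step (dt : R) c c' : Prop :=
  exists psi (g : 'I_m -> N.-tuple {poly R}),
    let M i := boltzmann (charge D i) psi in
    [/\ poisson c psi,
        forall i : 'I_m, g i \in Vh k /\
          forall r, r \in Vh k -> forall j, (j < N)%N ->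
            cell_int j (fun x => dx 0 (g i) j x * M i j x * dx 0 r j x)
            = cell_int j (fun x => dx 0 (c i) j x * dx 0 r j x)
      & forall i : 'I_m, c' i \in Vh k /\
          forall v, v \in Vh k -> forall j, (j < N)%N ->
            cell_int j (fun x =>
              (dx 0 (c' i) j x - dx 0 (c i) j x) / dt * dx 0 v j x)
            = - cell_int j (fun x => M i j x * dx 1 (g i) j x * dx 1 v j x)
              + cell_bracket (fun j l => avg (M i) l *
                  (g_flux (g i) l * dx 0 v j (node l)
                   + (dx 0 (g i) j (node l) - avg (dx 0 (g i)) l)
                     * dx 1 v j (node l))) j].

Definition is_L2_projection w v : Prop :=
  v \in Vh k /\
  forall r, r \in Vh k -> forall j, (j < N)%N ->
    cell_int j (fun x => dx 0 v j x * dx 0 r j x)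
    = cell_int j (fun x => w j x * dx 0 r j x).

Definition scale_pieces (a : R) v : N.-tuple {poly R} :=
  [tuple of map (fun p => a *: p) v].

Definition steady_state c : Prop :=
  exists (cinf : 'I_m -> R) phi (P : 'I_m -> N.-tuple {poly R}),
    [/\ forall i : 'I_m, 0 < cinf i,
        forall i : 'I_m, is_L2_projection (boltzmann (charge D i) phi) (P i),
        poisson (fun i => scale_pieces (cinf i) (P i)) phi
      & forall i : 'I_m, c i = scale_pieces (cinf i) (P i)].

End DDG.

(* Main.v *)
Require Import Defs.
From HB Require Import structures.
From mathcomp Require Import all_boot all_order all_algebra.
From mathcomp Require Import all_classical all_reals all_analysis.

Set Implicit Arguments.
Unset Strict Implicit.
Unset Printing Implicit Defensive.

Import Order.TTheory GRing.Theory Num.Theory.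
Import numFieldNormedType.Exports.
Local Open Scope ring_scope.

(** The idea is that a steady state is a fixed point of one step of the scheme,
    after which induction on the number of steps finishes.

    Let c_i = cinf_i Pi(M_i), where M_i = exp(- q_i phi) and phi solves the
    Poisson problem with data c.  The step first solves that same problem, so by
    unique solvability its potential is phi and its weights are the M_i.  The
    weighted projection g_i of c_i then satisfies
      int g_i M_i r = int c_i r = cinf_i int Pi(M_i) r = cinf_i int M_i r
    for every test function r, i.e. g_i - cinf_i is orthogonal to V_h in the
    inner product with weight M_i > 0.  As cinf_i itself lies in V_h, g_i is the
    constant cinf_i.  A global constant has no derivative and no jump, so all
    the volume and interface terms of the update vanish; the increment
    (c_i' - c_i) / dt is then orthogonal to V_h, hence zero.

    Both conclusions rest on the positive definiteness of the weighted inner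
    product on polynomials over a cell, [weighted_poly_definite], used in the
    form [weighted_Vh_definite]. *)

(** * Weighted inner products of polynomials *)

Section WeightedInnerProduct.
Context (R : realType).
Local Open Scope classical_set_scope.

Lemma finite_poly_roots (p : {poly R}) :
  p != 0 -> finite_set [set x | root p x].
Proof.
move=> p_neq0; apply: contrapT => /(infinite_set_fset (size p))[B Broots].
apply/negP; rewrite -ltnNge.
apply: (max_poly_roots p_neq0); last exact: finmap.fset_uniq.
by apply/allP => x xB; exact: Broots.
Qed.

Lemma continuous_integrable_segment (a b : R) (f : R -> R) :
  continuous f -> lebesgue_measure.-integrable `[a, b] (EFin \o f).
Proof.
move=> cf; apply: continuous_compact_integrable; first exact: segment_compact.
exact: continuous_subspaceT.
Qed.

(** The integrand is nonnegative, so it vanishes almost everywhere; were p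
    nonzero, its finitely many roots would make up almost all of [a, b]. *)
Lemma weighted_poly_definite (a b : R) (w : R -> R) (p : {poly R}) :
  a < b -> continuous w -> (forall x, 0 < w x) ->
  \int[lebesgue_measure]_(x in `[a, b]) (p.[x] * w x * p.[x]) = 0 ->
  p = 0.
Proof.
move=> ab cw w_gt0 int0; apply/eqP/negPn/negP => p_neq0.
set f := fun x => p.[x] * w x * p.[x] in int0.
have f_ge0 x : 0 <= f x by rewrite /f mulrAC mulr_ge0 ?sqr_ge0// ltW.
have cf : continuous f.
  move=> x; apply: cvgM; last exact: continuous_horner.
  by apply: cvgM; [exact: continuous_horner|exact: cw].
have fi := @continuous_integrable_segment a b _ cf.
have eint0 : (\int[lebesgue_measure]_(x in `[a, b]) `|(EFin \o f) x|)%E = 0%R.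
  under eq_integral do rewrite /= ger0_norm//.
  by rewrite -[LHS]fineK ?integrable_fin_num//; congr _%:E.
have ae0 := (ae_eq_integral_abs lebesgue_measure (measurable_itv _)
  (measurable_int _ fi)).1 eint0.
have ab_negl : lebesgue_measure.-negligible `[a, b].
  have roots_countable := finite_set_countable (finite_poly_roots p_neq0).
  have roots_negl : lebesgue_measure.-negligible [set x | root p x].
    apply/negligibleP; last exact: countable_lebesgue_measure0.
    by apply: countable_measurable roots_countable => x; exact: measurable_set1.
  apply: negligibleS (negligibleU roots_negl ae0) => x xab /=.
  case: (boolP (root p x)) => [|/rootP px]; [by left|right => /(_ xab)].
  move=> [] /eqP; rewrite /f !mulf_eq0 (gt_eqF (w_gt0 x)) orbF orbb.
  by move/eqP.
have : lebesgue_measure (`[a, b] : set R) = 0%E.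
  by apply/negligibleP => //; exact: measurable_itv.
rewrite lebesgue_measure_itv/= lte_fin ab -EFinB => -[] /eqP.
by rewrite subr_eq0 gt_eqF.
Qed.

End WeightedInnerProduct.

(** * Piecewise polynomials and cell integrals *)

Section Mesh.
Context (R : realType) (N k m : nat) (D : ddg_problem R m).
Hypothesis h_gt0 : 0 < meshsize D.
Implicit Types (u v r psi : N.-tuple {poly R}) (j : nat).

Lemma cell_intB j (f1 f2 : R -> R) : continuous f1 -> continuous f2 ->
  cell_int D j (fun x => f1 x - f2 x) = cell_int D j f1 - cell_int D j f2.
Proof.
move=> cf1 cf2; apply: RintegralB; first exact: measurable_itv.
  exact: continuous_integrable_segment.
exact: continuous_integrable_segment.
Qed.

Lemma cell_intZl j a (f : R -> R) : continuous f ->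
  cell_int D j (fun x => a * f x) = a * cell_int D j f.
Proof.
move=> cf; apply: RintegralZl; first exact: measurable_itv.
exact: continuous_integrable_segment.
Qed.

Lemma cell_int0 j (f : R -> R) : f =1 (fun=> 0) -> cell_int D j f = 0.
Proof.
move=> f0; rewrite /cell_int /Rintegral.
by under eq_integral do rewrite f0; rewrite integral0.
Qed.

Lemma VhP v : reflect (forall j, (size (v`_j)%R <= k.+1)%N) (v \in Vh k).
Proof.
apply: (iffP allP) => [szv j|szv p /(nthP 0)[j _ <-]]; last exact: szv.
have [jN|Nj] := ltnP j (size v); first exact/szv/mem_nth.
by rewrite nth_default// size_poly0.
Qed.

Definition sub_pieces u v : N.-tuple {poly R} :=
  [tuple tnth u l - tnth v l | l < N].

Lemma nth_sub_pieces u v j : (sub_pieces u v)`_j = u`_j - v`_j.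
Proof.
have [jN|Nj] := ltnP j N; last by rewrite !nth_default ?size_tuple// subr0.
by rewrite (nth_mktuple _ _ (Ordinal jN)) !(tnth_nth 0).
Qed.

Lemma nth_scale_pieces a v j : (scale_pieces a v)`_j = a *: v`_j.
Proof.
have [jN|Nj] := ltnP j (size v); first exact: nth_map.
by rewrite !nth_default ?scaler0// size_map.
Qed.

Definition cst_pieces (a : R) : N.-tuple {poly R} := [tuple a%:P | _ < N].

Lemma nth_cst_pieces a j : (j < N)%N -> (cst_pieces a)`_j = a%:P.
Proof. by move=> jN; rewrite (nth_mktuple _ _ (Ordinal jN)). Qed.

Lemma sub_pieces_Vh u v : u \in Vh k -> v \in Vh k -> sub_pieces u v \in Vh k.
Proof.
move=> /VhP uV /VhP vV; apply/VhP => j; rewrite nth_sub_pieces.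
by rewrite (leq_trans (size_polyD _ _))// geq_max size_polyN uV vV.
Qed.

Lemma scale_pieces_Vh a v : v \in Vh k -> scale_pieces a v \in Vh k.
Proof.
move=> /VhP vV; apply/VhP => j; rewrite nth_scale_pieces.
exact: leq_trans (size_scale_leq _ _) (vV j).
Qed.

Lemma cst_pieces_Vh a : cst_pieces a \in Vh k.
Proof.
apply/VhP => j; have [jN|Nj] := ltnP j N.
  by rewrite nth_cst_pieces// (leq_trans (size_polyC_leq1 a)).
by rewrite nth_default ?size_tuple// size_poly0.
Qed.

Lemma continuous_dx l v j : continuous (dx l v j).
Proof. exact: continuous_horner. Qed.

Lemma continuous_boltzmann q psi j : continuous (boltzmann q psi j).
Proof.
move=> x; apply: continuous_comp; last exact: continuous_expR.
by apply: cvgM; [exact: cvg_cst|exact: continuous_dx].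
Qed.

Lemma continuous_mul (f1 f2 : R -> R) :
  continuous f1 -> continuous f2 -> continuous (fun x => f1 x * f2 x).
Proof. by move=> cf1 cf2 x; apply: cvgM; [exact: cf1|exact: cf2]. Qed.

(** The difference u - v is an admissible test function, so that testing
    against it yields its weighted norm. *)
Lemma weighted_Vh_definite u v (w : broken R) : u \in Vh k -> v \in Vh k ->
  (forall j, continuous (w j)) -> (forall j x, 0 < w j x) ->
  (forall r, r \in Vh k -> forall j, (j < N)%N ->
    cell_int D j (fun x => (dx 0 u j x - dx 0 v j x) * w j x * dx 0 r j x)
    = 0) ->
  u = v.
Proof.
move=> uV vV cw w_gt0 orth; apply/eqP; rewrite eqEtuple; apply/forallP => l.
rewrite !(tnth_nth 0) -subr_eq0; apply/eqP.
apply: (@weighted_poly_definite _ (node D l) (node D l.+1) (w l)) => //.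
  by rewrite /node ltrD2l ltr_pM2r// ltr_nat.
have := orth _ (sub_pieces_Vh uV vV) _ (ltn_ord l).
rewrite /cell_int /dx /= nth_sub_pieces => <-; apply: eq_Rintegral => x _.
by rewrite !hornerE.
Qed.

End Mesh.

(** * One step of the scheme *)

Section Step.
Context (R : realType) (N k m : nat) (D : ddg_problem R m).
Hypothesis h_gt0 : 0 < meshsize D.
Implicit Types (c : 'I_m -> N.-tuple {poly R}) (psi g p r v : N.-tuple {poly R}).
Implicit Types (a x : R).

Lemma dx0_cst_pieces a j x : (j < N)%N -> dx 0 (cst_pieces N a) j x = a.
Proof. by move=> jN; rewrite /dx nth_cst_pieces//= hornerC. Qed.

Lemma dxS_cst_pieces l a j x :
  (j < N)%N -> dx l.+1 (cst_pieces N a) j x = 0.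
Proof. by move=> jN; rewrite /dx nth_cst_pieces// derivnC horner0. Qed.

Lemma avg_cst (w : broken R) a i : (0 < N)%N -> (i <= N)%N ->
  (forall j x, (j < N)%N -> w j x = a) -> avg N D w i = a.
Proof.
move=> N_gt0 iN wa; rewrite /avg; case: eqP => [_|/eqP i0]; first exact: wa.
case: eqP => [_|/eqP iNN]; first by rewrite wa// ltn_predL.
have ltiN : (i < N)%N by rewrite ltn_neqAle iNN.
rewrite !wa// ?(leq_ltn_trans (leq_pred _))//.
by rewrite -mulr2n -(mulr_natr a) mulfK// pnatr_eq0.
Qed.

Lemma jump_cst (w : broken R) a i : (i < N)%N ->
  (forall j x, (j < N)%N -> w j x = a) -> jump D w i = 0.
Proof.
by move=> iN wa; rewrite /jump !wa ?subrr// (leq_ltn_trans (leq_pred _)).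
Qed.

Lemma g_flux_cst a i : (0 < N)%N -> (i <= N)%N ->
  g_flux D (cst_pieces N a) i = 0.
Proof.
move=> N_gt0 iN; rewrite /g_flux; case: ifPn => //.
rewrite negb_or => /andP[_ iNN]; have ltiN : (i < N)%N by rewrite ltn_neqAle iNN.
rewrite /interior_flux (@jump_cst _ a) => [|//|j x jN]; last exact: dx0_cst_pieces.
rewrite (@avg_cst _ 0) => [|//|//|j x jN]; last exact: dxS_cst_pieces.
rewrite (@jump_cst _ 0) => [|//|j x jN]; last exact: dxS_cst_pieces.
by rewrite !mulr0 !addr0.
Qed.

(** In the variable g the Boltzmann distribution cinf exp(- q psi) is the
    constant cinf, and this survives projection: the weighted projection g
    sees c only through its moments against V_h, and the unweighted projection p
    of exp(- q psi) has the same such moments as exp(- q psi) itself. *)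
Lemma weighted_projection_of_equilibrium q a psi g p :
  is_L2_projection k D (boltzmann q psi) p -> g \in Vh k ->
  (forall r, r \in Vh k -> forall j, (j < N)%N ->
    cell_int D j (fun x => dx 0 g j x * boltzmann q psi j x * dx 0 r j x)
    = cell_int D j (fun x => dx 0 (scale_pieces a p) j x * dx 0 r j x)) ->
  g = cst_pieces N a.
Proof.
move=> [pV projp] gV projg.
apply: (weighted_Vh_definite h_gt0 (w := boltzmann q psi) gV).
- exact: cst_pieces_Vh.
- exact: continuous_boltzmann.
- by move=> j x; exact: expR_gt0.
move=> r rV j jN.
have cMr : continuous (fun x => boltzmann q psi j x * dx 0 r j x).
  apply: continuous_mul; [exact: continuous_boltzmann|exact: continuous_dx].
transitivity (cell_int D j (fun x =>
    dx 0 g j x * boltzmann q psi j x * dx 0 r j x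
    - a * (boltzmann q psi j x * dx 0 r j x))).
  apply: eq_Rintegral => x _.
  by rewrite dx0_cst_pieces// mulrA -!mulrBl.
rewrite cell_intB; last 2 first.
- apply: continuous_mul; last exact: continuous_dx.
  by apply: continuous_mul; [exact: continuous_dx|exact: continuous_boltzmann].
- by apply: continuous_mul => // x; exact: cvg_cst.
rewrite projg// cell_intZl// -projp// -cell_intZl; last first.
  by apply: continuous_mul; exact: continuous_dx.
apply/eqP; rewrite subr_eq0; apply/eqP; apply: eq_Rintegral => x _.
by rewrite /dx nth_scale_pieces/= hornerZ mulrA.
Qed.

(** A constant g has neither gradient nor jump, so nothing drives the update:
    the increment is orthogonal to V_h, for the constant weight 1 / dt. *)
Lemma update_of_cst_g dt a (M : broken R) (u u' : N.-tuple {poly R}) :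
  (0 < N)%N -> 0 < dt -> u \in Vh k -> u' \in Vh k ->
  (forall v, v \in Vh k -> forall j, (j < N)%N ->
    let g := cst_pieces N a in
    cell_int D j (fun x => (dx 0 u' j x - dx 0 u j x) / dt * dx 0 v j x)
    = - cell_int D j (fun x => M j x * dx 1 g j x * dx 1 v j x)
      + cell_bracket (fun j l => avg N D M l *
          (g_flux D g l * dx 0 v j (node D l)
           + (dx 0 g j (node D l) - avg N D (dx 0 g) l)
             * dx 1 v j (node D l))) j) ->
  u' = u.
Proof.
move=> N_gt0 dt_gt0 uV u'V upd.
apply: (weighted_Vh_definite h_gt0 (w := fun _ _ => dt^-1) u'V uV).
- by move=> j x; exact: cvg_cst.
- by move=> j x; rewrite invr_gt0.
move=> v vV j jN; rewrite upd// cell_int0 => [|x]; last first.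
  by rewrite dxS_cst_pieces// mulr0 mul0r.
have avga l : (l <= N)%N -> avg N D (dx 0 (cst_pieces N a)) l = a.
  by move=> lN; apply: avg_cst => // i x iN; exact: dx0_cst_pieces.
rewrite /cell_bracket !g_flux_cst ?(ltnW jN)// !avga ?(ltnW jN)//.
by rewrite !dx0_cst_pieces// !subrr !mul0r !addr0 !mulr0 subrr oppr0 addr0.
Qed.

Lemma steady_state_fixed dt c c' : (0 < N)%N -> 0 < dt ->
  poisson_uniquely_solvable N k D -> steady_state k D c ->
  ddg_step k D dt c c' -> c' = c.
Proof.
move=> N_gt0 dt_gt0 DP [cinf [phi [P [_ projP DPphi cE]]]].
have {}cE : c = fun i => scale_pieces (cinf i) (P i) by apply/funext.
have cV i : c i \in Vh k by rewrite cE; apply: scale_pieces_Vh; case: (projP i).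
move=> [psi [g [DPpsi gP updP]]].
have psiE : psi = phi.
  have [psi0 [_ uniq_psi0]] := DP c cV.
  by rewrite -(uniq_psi0 _ DPpsi) (uniq_psi0 phi) // cE.
rewrite psiE in gP updP.
apply/funext => i.
have gE : g i = cst_pieces N (cinf i).
  have [gV gproj] := gP i.
  apply: weighted_projection_of_equilibrium (projP i) gV _ => r rV j jN.
  by rewrite gproj// cE.
have [c'V upd] := updP i; rewrite gE in upd.
exact: update_of_cst_g N_gt0 dt_gt0 (cV i) c'V upd.
Qed.

End Step.

Theorem theorem3p5 (R : realType) (N k m : nat) (D : ddg_problem R m) (dt : R)
    (c : nat -> 'I_m -> N.-tuple {poly R})
    (N_gt0 : (0 < N)%N) (h_gt0 : 0 < meshsize D) (dt_gt0 : 0 < dt)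
    (DP : poisson_uniquely_solvable N k D)
    (scheme : forall n, ddg_step k D dt (c n) (c n.+1))
    (steady0 : steady_state k D (c 0%N)) :
  forall n, (1 <= n)%N -> forall i : 'I_m, c n i = c 0%N i.
Proof.
have cn n : c n = c 0%N.
  elim: n => [//|n IHn]; rewrite -[RHS]IHn.
  by apply: steady_state_fixed (scheme n) => //; rewrite IHn.
by move=> n _ i; rewrite cn.
Qed.
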